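(* Let $n\in\{1,2\}$ and consider the free wave equation $$\begin{cases} w_{tt}-\Delta w=0,\\ w(0,x)=w_0(x),\ w_t(0,x)=w_1(x),\end{cases}\qquad (t,x)\in\mathbb{R}_+\times\mathbb{R}^n,$$ with initial data $w_0\in L^2$ and $w_1\in L^1$. Then the solution $w$ satisfies $$\|w(t,\cdot)\|_{L^2}\gtrsim\begin{cases}\sqrt t\,|P_{w_1}| & \text{if } n=1,\\ \sqrt{\ln t}\,|P_{w_1}| & \text{if } n=2,\end{cases}$$ for any $t\gg1$.
   Context: $P_{w_1}:=\int_{\mathbb{R}^n}w_1(x)\,\mathrm{d}x$. The solution is the one given in the Fourier space by $\widehat w(t,\xi)=\cos(|\xi|t)\widehat w_0(\xi)+\frac{\sin(|\xi|t)}{|\xi|}\widehat w_1(\xi)$, and $\|w(t,\cdot)\|_{L^2}\in[0,\infty]$ is understood via Plancherel. $f\gtrsim h$ means $f\ge Ch$ with a constant $C>0$ independent of $t$ and of the data; ''for $t\gg1$'' means for all sufficiently large $t$, where the threshold may depend on $w_0,w_1$. *)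

(* Defs.v *)
From HB Require Import structures.
From mathcomp Require Import all_boot all_order all_algebra.
From mathcomp Require Import complex.
From mathcomp Require Import all_classical all_reals all_analysis.

Set Implicit Arguments.
Unset Strict Implicit.
Unset Printing Implicit Defensive.
Import Order.TTheory GRing.Theory Num.Theory.
Import numFieldNormedType.Exports.

Local Open Scope classical_set_scope.
Local Open Scope complex_scope.
Local Open Scope ring_scope.

Definition cmod (R : realType) (z : R[i]) : R := ComplexField.Normc.normc z.

(* The library has no Lebesgue measure on 'rV[R]_n; R^1 is R with
   lebesgue_measure and R^2 is R * R with the product measure. All notions below
   are stated for a measurable space T with measure mu, an inner product
   dot : T -> T -> R, and the dimension n (used only in the Plancherel
   constant). *)
Definition dot1 (R : realType) (x y : measurableTypeR R) : R := x * y.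

Definition dot2 (R : realType) (x y : measurableTypeR R * measurableTypeR R) : R :=
  x.1 * y.1 + x.2 * y.2.

Definition leb1 (R : realType) : {measure set (measurableTypeR R) -> \bar R} :=
  @lebesgue_measure R.

Definition leb2 (R : realType) :
    {measure set (measurableTypeR R * measurableTypeR R) -> \bar R} :=
  (@lebesgue_measure R \x @lebesgue_measure R)%E.

Section fourier.
Context {d : measure_display} {T : measurableType d} {R : realType}.
Variables (mu : {measure set T -> \bar R}) (dot : T -> T -> R).
Implicit Types (f F : T -> R[i]) (p : R) (x xi : T).

Definition enorm x : R := Num.sqrt (dot x x).

Definition CLnorm p f : \bar R := Lnorm mu p%:E (fun x => (cmod (f x))%:E).

Definition inLp p f : Prop :=
  [/\ measurable_fun [set: T] (fun x => complex.Re (f x)),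
      measurable_fun [set: T] (fun x => complex.Im (f x)) &
      (CLnorm p f < +oo)%E].

Definition Cintegral f : R[i] :=
  Rintegral mu [set: T] (fun x => complex.Re (f x)) +i*
  Rintegral mu [set: T] (fun x => complex.Im (f x)).

Definition cis (theta : R) : R[i] := cos theta +i* sin theta.

(* Fourier transform of an L^1 function: \int exp(- i x.xi) f(x) dx *)
Definition fourier f xi : R[i] :=
  Cintegral (fun x => cis (- dot x xi) * f x).

Definition truncate (r : R) f x : R[i] := if enorm x <= r then f x else 0.

(* F is a representative of the L^2 (Plancherel) Fourier transform of the L^2
   function f: the limit in L^2 of the Fourier transforms of its truncations,
   which are in L^1 and L^2. It exists and is unique up to null sets by
   Plancherel's theorem. *)
Definition is_fourier_L2 f F : Prop :=
  inLp 2 F /\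
  (CLnorm 2 (fun xi => fourier (truncate r f) xi - F xi)
     @[r --> +oo] --> 0%E).

(* Fourier transform of the solution of the free wave equation, W0 and W1 being
   the Fourier transforms of the data. The value at enorm xi = 0, where the
   quotient is 0 / 0 = 0, is irrelevant since {0} is a null set. *)
Definition wave_fourier (W0 W1 : T -> R[i]) (t : R) xi : R[i] :=
  (cos (enorm xi * t))%:C * W0 xi + (sin (enorm xi * t) / enorm xi)%:C * W1 xi.

(* L^2 norm, in [0, +oo], of the object with Fourier transform F on R^n, through
   Plancherel's identity ||f|| = (2 pi)^(- n / 2) ||F||. *)
Definition plancherel_norm (n : nat) F : \bar R :=
  (((2 * pi) `^ (- (n%:R / 2)))%:E * CLnorm 2 F)%E.

End fourier.

(* Main.v *)
(** Write W1 for the Fourier transform of w1 and P for its value at 0. Pointwise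
[|cos W0 + s W1|^2 >= s^2 |W1|^2 / 2 - |W0|^2] with [s = sin (t |xi|) / |xi|],
and [|W1| >= |P| / 2] on a small ball around 0, by dominated convergence. As
W0 is in L^2, it remains to see that the integral of [s^2] over any ball
around 0 grows like [t] in dimension 1 and like [ln t] in dimension 2.
In dimension 1, [s >= t / 2] on ]0, 1/t]. In dimension 2, every cell
[[j, j + 1[ x [k, k + 1[ / t] with [k < j <= sqrt t] contains a box of area of
order [t^-2] on which [|sin (t |xi|)|] is bounded below, hence contributes at
least a constant times [j^-2]; summing over [k] and then [j] gives the
harmonic sum. *)

Require Import Defs.
From HB Require Import structures.
From mathcomp Require Import all_boot all_order all_algebra.
From mathcomp Require Import complex ring lra.
From mathcomp Require Import all_classical all_reals all_analysis.
From mathcomp Require Import measurable_realfun.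

Set Implicit Arguments.
Unset Strict Implicit.
Unset Printing Implicit Defensive.
Import Order.TTheory GRing.Theory Num.Theory.
Import numFieldNormedType.Exports.

Local Open Scope classical_set_scope.
Local Open Scope complex_scope.
Local Open Scope ring_scope.

(** * Elementary bounds on sine and cosine *)

Section trigonometry.
Context {R : realType}.
Implicit Types x y : R.

Lemma sin_lipschitz x y : `|sin x - sin y| <= `|x - y|.
Proof.
wlog yx : x y / y <= x.
  move=> H; have [/H//|/ltW/H] := leP y x.
  by rewrite distrC [leRHS]distrC.
have [|z _ ->] := @MVT_segment R sin cos y x yx (fun z _ => is_derive_sin z).
  by apply: continuous_subspaceT => z; exact: continuous_sin.
by rewrite normrM ler_piMl// cos_max.
Qed.

Lemma cos_lipschitz x y : `|cos x - cos y| <= `|x - y|.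
Proof.
wlog yx : x y / y <= x.
  move=> H; have [/H//|/ltW/H] := leP y x.
  by rewrite distrC [leRHS]distrC.
have [|z _ ->] := @MVT_segment R cos (fun z => - sin z) y x yx
    (fun z _ => is_derive_cos z).
  by apply: continuous_subspaceT => z; exact: continuous_cos.
by rewrite normrM normrN ler_piMl// sin_max.
Qed.

(** Half-angle formula: [cos x = 1 - 2 * sin (x / 2) ^+ 2], which is at least [1 - x ^+ 2 / 2]. *)
Lemma cos_ge_half x : 0 <= x <= 1 -> 2^-1 <= cos x.
Proof.
move=> /andP[x0 x1].
rewrite {1}(_ : x = (x / 2) *+ 2); last by rewrite -mulr_natr; lra.
rewrite cos_mulr2n cos2sin2.
have := sin_lipschitz (x / 2) 0; rewrite sin0 !subr0 => sx.
have : sin (x / 2) ^+ 2 <= (x / 2) ^+ 2.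
  by rewrite -(real_normK (num_real (sin _))) -(real_normK (num_real (x / 2)))
    lerXn2r// nnegrE.
rewrite -mulr_natr; nra.
Qed.

(** Mean value theorem from 0, the slope being a cosine bounded by [cos_ge_half]. *)
Lemma sin_ge_half x : 0 <= x <= 1 -> x / 2 <= sin x.
Proof.
move=> /andP[x0 x1].
have [|z] := @MVT_segment R sin cos 0 x x0 (fun z _ => is_derive_sin z).
  by apply: continuous_subspaceT => z; exact: continuous_sin.
rewrite in_itv/= sin0 !subr0 => /andP[z0 zx] ->.
rewrite mulrC ler_wpM2r// cos_ge_half// z0/=; lra.
Qed.

End trigonometry.

(** * The complex modulus, its real and imaginary parts, and measurability *)

Section cmod.
Context {R : realType}.
Implicit Types z : R[i].

Lemma cmod_sqr z : cmod z ^+ 2 = complex.Re z ^+ 2 + complex.Im z ^+ 2.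
Proof. by case: z => a b; rewrite /cmod/= sqr_sqrtr// addr_ge0// sqr_ge0. Qed.

Lemma cmod_ge0 z : 0 <= cmod z.
Proof. by case: z => a b; exact: sqrtr_ge0. Qed.

Lemma normr_Re_le_cmod z : `|complex.Re z| <= cmod z.
Proof.
rewrite -ler_sqr ?nnegrE ?cmod_ge0//.
by rewrite cmod_sqr real_normK ?num_real// lerDl sqr_ge0.
Qed.

Lemma normr_Im_le_cmod z : `|complex.Im z| <= cmod z.
Proof.
rewrite -ler_sqr ?nnegrE ?cmod_ge0//.
by rewrite cmod_sqr real_normK ?num_real// lerDr sqr_ge0.
Qed.

Lemma cmod_le_ReIm z : cmod z <= `|complex.Re z| + `|complex.Im z|.
Proof.
rewrite -ler_sqr ?nnegrE ?cmod_ge0 ?addr_ge0//.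
rewrite cmod_sqr sqrrD !real_normK ?num_real//.
by rewrite addrAC lerDl mulrn_wge0// mulr_ge0.
Qed.

Lemma measurable_cmod {d : measure_display} {T : measurableType d}
    (f : T -> R[i]) :
  measurable_fun setT (fun x => complex.Re (f x)) ->
  measurable_fun setT (fun x => complex.Im (f x)) ->
  measurable_fun setT (fun x => cmod (f x)).
Proof.
move=> mr mi.
rewrite (_ : (fun x => cmod (f x)) = (fun x => Num.sqrt
    (complex.Re (f x) ^+ 2 + complex.Im (f x) ^+ 2))); last first.
  by apply/funext => x; case: (f x).
apply: (measurableT_comp (continuous_measurable_fun (@sqrt_continuous R))).
by apply: measurable_funD; exact: measurable_funX.
Qed.

End cmod.

(** * Continuity at the origin of the Fourier transform of an integrable function *)

Section fourier_near_zero.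
Context {d : measure_display} {T : measurableType d} {R : realType}.
Implicit Types (mu : {measure set T -> \bar R}) (dot : T -> T -> R).

Lemma le_normr_RintegralB mu (f g h : T -> R) :
  mu.-integrable setT (EFin \o f) -> mu.-integrable setT (EFin \o g) ->
  mu.-integrable setT (EFin \o h) -> (forall x, `|f x - g x| <= h x) ->
  `|Rintegral mu setT f - Rintegral mu setT g| <= Rintegral mu setT h.
Proof.
move=> intf intg inth fgh.
have intfg : mu.-integrable setT (EFin \o (f \- g)).
  rewrite (_ : EFin \o _ = (EFin \o f) \- (EFin \o g))%E//.
  exact: integrableB.
rewrite -RintegralB//; apply: le_trans (le_normr_Rintegral measurableT intfg) _.
apply: le_Rintegral => //; first exact: integrable_norm intfg.
by move=> x _; exact: fgh.
Qed.

Lemma inL1_cmod mu (w : T -> R[i]) :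
  inLp mu 1 w -> mu.-integrable setT (EFin \o (fun x => cmod (w x))).
Proof.
move=> [mr mi]; rewrite /CLnorm Lnorm1 => woo.
by apply/integrableP; split => //; apply/measurable_EFinP/measurable_cmod.
Qed.

(** By Cauchy-Schwarz the phase [dot x xi] is small for small [xi], pointwise in [x]. Dominated
    convergence is applied to a majorant that depends on [xi] only through the radius of a ball, so
    that a sequence of radii suffices. *)
Lemma fourier_near0 mu dot (w : T -> R[i]) (e : R) :
  (forall xi, measurable_fun setT (dot^~ xi)) ->
  measurable_fun setT (enorm dot) ->
  (forall x xi, `|dot x xi| <= enorm dot x * enorm dot xi) ->
  inLp mu 1 w -> 0 < e ->
  exists2 delta, 0 < delta & forall xi, enorm dot xi <= delta ->
    cmod (fourier mu dot w xi - Cintegral mu w) <= e.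
Proof.
move=> mdot menorm cauchy_schwarz w1 e0.
have [mr mi _] := w1.
have im := inL1_cmod w1.
pose m x := cmod (w x).
have m0 x : 0 <= m x by exact: cmod_ge0.
have mm : measurable_fun setT m by exact: measurable_cmod.
have i2m : mu.-integrable setT (EFin \o (fun x => 2 * m x)).
  rewrite (_ : EFin \o _ = (fun x => 2%:E * (m x)%:E)%E)//.
  exact: integrableZl.
have intle (f : T -> R) : measurable_fun setT f -> (forall x, `|f x| <= 2 * m x) ->
    mu.-integrable setT (EFin \o f).
  move=> mf fm; apply: le_integrable i2m => //; first exact/measurable_EFinP.
  by move=> x _ /=; rewrite lee_fin (le_trans (fm x))// ler_norm.
(* For [xi] in the ball of radius [1 / (n + 1)], [k n x] bounds both the real and the imaginary part
   of [cis (- dot x xi) - 1]. The cap 2 provides the integrable majorant [2 * m x]. *)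
pose k n x : R := Num.min 2 (enorm dot x / n.+1%:R).
have k0 n x : 0 <= k n x.
  by rewrite /k le_min ler0n/= divr_ge0// sqrtr_ge0.
pose phi n x : R := k n x * m x.
have mphi n : measurable_fun setT (phi n).
  apply: measurable_funM => //; apply: measurable_minr => //.
  exact: measurable_funM.
have phi2 n x : `|phi n x| <= 2 * m x.
  by rewrite /phi ger0_norm ?mulr_ge0// ler_wpM2r// ge_min lexx.
have phi0 x : phi n x @[n --> \oo] --> (0 : R).
  apply: (@squeeze_cvgr _ _ _ _ (cst 0)
      (fun n => enorm dot x * m x * n.+1%:R^-1)).
  - apply: nearW => n; rewrite /cst mulr_ge0//=.
    by rewrite mulrAC ler_wpM2r// ge_min lexx orbT.
  - exact: cvg_cst.
  - rewrite -[X in _ --> X](mulr0 (enorm dot x * m x)).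
    by apply: cvgMl_tmp; exact: cvg_harmonic.
have [_ _ cvgphi] : [/\ mu.-integrable setT (cst 0%E : T -> \bar R),
    [sequence \int[mu]_x (`|(phi n x)%:E - cst 0 x|)]_n @ \oo --> 0 &
    [sequence \int[mu]_x (phi n x)%:E]_n @ \oo --> \int[mu]_x (cst 0 x)]%E.
  apply: (@dominated_convergence _ _ _ mu _ measurableT
     (fun n x => (phi n x)%:E) (cst 0%E) (EFin \o (fun x => 2 * m x))) => //.
  - by move=> n; exact/measurable_EFinP.
  - by apply: aeW => x _; apply: cvg_EFin; [exact: nearW|exact: phi0].
  - by apply: aeW => x n _; rewrite lee_fin.
rewrite integral0 in cvgphi.
have {}cvgphi : Rintegral mu setT (phi n) @[n --> \oo] --> (0 : R).
  by have /fine_cvgP[_] := cvgphi.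
(* The real and the imaginary part each cost two integrals of [phi n], and [cmod] is at most the sum
   of both: four in all. *)
have e4 : 0 < e / 4 by rewrite divr_gt0.
have /filter_ex[n phine] : \forall n \near \oo, Rintegral mu setT (phi n) < e / 4.
  exact: cvgr_lt cvgphi _ e4.
exists n.+1%:R^-1; first by rewrite invr_gt0.
move=> xi xin.
pose th x := - dot x xi.
have mth : measurable_fun setT th by exact: measurableT_comp.
have mcos : measurable_fun setT (fun x => cos (th x)).
  exact: (measurableT_comp (continuous_measurable_fun (@continuous_cos R)) mth).
have msin : measurable_fun setT (fun x => sin (th x)).
  exact: (measurableT_comp (continuous_measurable_fun (@continuous_sin R)) mth).
have thk x : `|th x| <= enorm dot x / n.+1%:R.
  rewrite normrN (le_trans (cauchy_schwarz _ _))// ler_wpM2l// sqrtr_ge0//.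
have cosk x : `|cos (th x) - 1| <= k n x.
  rewrite le_min; apply/andP; split.
    by rewrite (le_trans (ler_normB _ _))// normr1 -[2]/(1 + 1) lerD2r cos_max.
  by have := cos_lipschitz (th x) 0; rewrite cos0 subr0 => /le_trans; apply.
have sink x : `|sin (th x)| <= k n x.
  rewrite le_min; apply/andP; split.
    by rewrite (le_trans (sin_max _))// ler1n.
  by have := sin_lipschitz (th x) 0; rewrite sin0 !subr0 => /le_trans; apply.
have i2phi : mu.-integrable setT (EFin \o (fun x => 2 * phi n x)).
  rewrite (_ : EFin \o _ = (fun x => 2%:E * (phi n x)%:E)%E)//.
  by apply: integrableZl => //; exact: intle.
have ReM x : complex.Re (cis (th x) * w x) =
    cos (th x) * complex.Re (w x) - sin (th x) * complex.Im (w x).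
  by rewrite /cis; case: (w x).
have ImM x : complex.Im (cis (th x) * w x) =
    cos (th x) * complex.Im (w x) + sin (th x) * complex.Re (w x).
  by rewrite /cis; case: (w x).
have bnd2 (a b u v x y : R) : `|a| <= u -> `|b| <= u -> `|x| <= v -> `|y| <= v ->
    `|a * x + b * y| <= 2 * (u * v).
  move=> au bu xv yv; rewrite (le_trans (ler_normD _ _))// !normrM.
  by rewrite mulr_natl mulr2n lerD// ler_pM.
have rew x : `|complex.Re (w x)| <= m x by exact: normr_Re_le_cmod.
have imw x : `|complex.Im (w x)| <= m x by exact: normr_Im_le_cmod.
have Rebnd : `|complex.Re (fourier mu dot w xi) - complex.Re (Cintegral mu w)|
    <= 2 * (e / 4).
  apply: (@le_trans _ _ (Rintegral mu setT (fun x => 2 * phi n x))); last first.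
    rewrite RintegralZl//; last exact: intle.
    by rewrite ler_wpM2l// ltW.
  rewrite /fourier /Cintegral /=; apply: le_normr_RintegralB => //.
  - apply: intle => [|x].
      under eq_fun do rewrite -/(th _) ReM.
      by apply: measurable_funB; exact: measurable_funM.
    rewrite -/(th _) ReM -mulNr (le_trans (bnd2 _ _ 1 (m x) _ _ _ _ _ _))//.
    + exact: cos_max.
    + by rewrite normrN sin_max.
    + by rewrite mul1r.
  - apply: intle => // x; rewrite (le_trans (rew x))// ler_peMl// ler1n//.
  - move=> x; rewrite -/(th _) ReM.
    rewrite (_ : _ - _ = (cos (th x) - 1) * complex.Re (w x) +
       (- sin (th x)) * complex.Im (w x)); last by ring.
    by apply: bnd2 => //; rewrite normrN.
have Imbnd : `|complex.Im (fourier mu dot w xi) - complex.Im (Cintegral mu w)|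
    <= 2 * (e / 4).
  apply: (@le_trans _ _ (Rintegral mu setT (fun x => 2 * phi n x))); last first.
    rewrite RintegralZl//; last exact: intle.
    by rewrite ler_wpM2l// ltW.
  rewrite /fourier /Cintegral /=; apply: le_normr_RintegralB => //.
  - apply: intle => [|x].
      under eq_fun do rewrite -/(th _) ImM.
      by apply: measurable_funD; exact: measurable_funM.
    rewrite -/(th _) ImM (le_trans (bnd2 _ _ 1 (m x) _ _ _ _ _ _))//.
    + exact: cos_max.
    + exact: sin_max.
    + by rewrite mul1r.
  - apply: intle => // x; rewrite (le_trans (imw x))// ler_peMl// ler1n//.
  - move=> x; rewrite -/(th _) ImM.
    rewrite (_ : _ - _ = (cos (th x) - 1) * complex.Im (w x) +
       sin (th x) * complex.Re (w x)); last by ring.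
    exact: bnd2.
rewrite (le_trans (cmod_le_ReIm _))//.
rewrite (_ : e = 2 * (e / 4) + 2 * (e / 4)); last by lra.
by move: Rebnd Imbnd; case: (fourier _ _ _ _) => a b; case: (Cintegral _ _) => a' b';
  exact: lerD.
Qed.

End fourier_near_zero.

(** * Reduction of the theorem to the growth of an integral over small balls *)

Section lower_bound.
Context {d : measure_display} {T : measurableType d} {R : realType}.
Implicit Types (mu : {measure set T -> \bar R}) (dot : T -> T -> R).

(* The integral of a nonnegative function is a supremum over simple functions
   below it, hence is monotone even on non-measurable functions. *)
Lemma le_integral_ge0 mu (f g : T -> \bar R) :
  (forall x, 0 <= f x)%E -> (forall x, f x <= g x)%E ->
  (\int[mu]_x f x <= \int[mu]_x g x)%E.
Proof.
move=> f0 fg; have g0 x : (0 <= g x)%E by exact: le_trans (fg x).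
rewrite !ge0_integralTE//; apply: ereal_sup_le => r [h hf hr].
by exists h => // x; exact: le_trans (fg x).
Qed.

Lemma CLnorm2E mu (F : T -> R[i]) :
  CLnorm mu 2 F = ((\int[mu]_x (cmod (F x) ^+ 2)%:E) `^ 2^-1)%E.
Proof.
rewrite /CLnorm unlock; congr (_ `^ _)%E; apply: eq_integral => x _ /=.
by rewrite ger0_norm ?cmod_ge0// powR_mulrn// cmod_ge0.
Qed.

(** Componentwise, with [A = a * x] and [B = s * y], the identity is [(A + B)^2 + A^2 - B^2 / 2 = (2
    A + B)^2 / 2]. *)
Lemma cmod_sqr_comb_ge (a s : R) (z w : R[i]) : `|a| <= 1 ->
  s ^+ 2 * cmod w ^+ 2 / 2 - cmod z ^+ 2 <= cmod (a%:C * z + s%:C * w) ^+ 2.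
Proof.
move=> a1; rewrite !cmod_sqr.
have {a1} : a ^+ 2 <= 1 by rewrite -(real_normK (num_real a)) expr_le1.
case: z => z1 z2; case: w => w1 w2 /=.
rewrite !mul0r !subr0 !addr0.
have H (x y : R) : a ^+ 2 <= 1 ->
    s ^+ 2 * y ^+ 2 / 2 - x ^+ 2 <= (a * x + s * y) ^+ 2.
  move=> a1; rewrite lerBlDr.
  apply: (@le_trans _ _ ((a * x + s * y) ^+ 2 + (a * x) ^+ 2)); last first.
    by rewrite lerD2l exprMn ler_piMl// sqr_ge0.
  rewrite -subr_ge0 (_ : _ - _ = (2 * (a * x) + s * y) ^+ 2 / 2).
    by rewrite divr_ge0// sqr_ge0.
  by field.
move=> a1; have := H z1 w1 a1; have := H z2 w2 a1; lra.
Qed.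

Lemma measurable_enorm_ball dot (delta : R) : measurable_fun setT (enorm dot) ->
  measurable [set xi | enorm dot xi <= delta].
Proof.
move=> menorm; rewrite -[X in measurable X]setTI.
by apply: measurable_fun_le => //; exact: measurable_cst.
Qed.

Lemma measurable_sinc dot (t : R) : measurable_fun setT (enorm dot) ->
  measurable_fun setT (fun xi => sin (enorm dot xi * t) / enorm dot xi).
Proof.
move=> menorm; apply: measurable_funM.
  apply: (measurableT_comp (continuous_measurable_fun (@continuous_sin R))).
  exact: measurable_funM.
(* The inverse is a measurable power function on nonnegative arguments; both take the value 0 at
   0. *)
rewrite (_ : (fun xi => _) = (@powR R ^~ (-1)) \o enorm dot).
  by apply: (measurableT_comp _ menorm); exact: measurable_powR.
by apply/funext => xi /=; rewrite powR_inv1// sqrtr_ge0.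
Qed.

(** The constant [c] is fixed before [delta]. The radius provided by [fourier_near0] depends on [w],
    but it only moves the threshold in [t], so the final constant is independent of the data. *)
Lemma wave_fourier_ge mu dot (c : R) (h : R -> R) (w W0 : T -> R[i]) :
  (forall xi, measurable_fun setT (dot^~ xi)) ->
  measurable_fun setT (enorm dot) ->
  (forall x xi, `|dot x xi| <= enorm dot x * enorm dot xi) ->
  0 < c -> h t @[t --> +oo] --> +oo ->
  (forall delta : R, 0 < delta -> \forall t \near +oo,
    ((c * h t)%:E <= \int[mu]_(xi in [set xi | (enorm dot xi <= delta)%R])
      ((sin (enorm dot xi * t) / enorm dot xi) ^+ 2)%:E)%E) ->
  inLp mu 2 W0 -> inLp mu 1 w ->
  \forall t \near +oo,
    ((Num.sqrt (c / 16) * (Num.sqrt (h t) * cmod (Cintegral mu w)))%:E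
     <= CLnorm mu 2 (wave_fourier dot W0 (fourier mu dot w) t))%E.
Proof.
move=> mdot menorm cauchy_schwarz c0 hoo ball_ge [mr mi W0oo] w1.
(* A vanishing mean makes the bound trivial; otherwise half its modulus is an admissible tolerance
   near 0. *)
have [P0|P0] := eqVneq (cmod (Cintegral mu w)) 0.
  by apply: nearW => t; rewrite P0 !mulr0 Lnorm_ge0.
have {P0} : 0 < cmod (Cintegral mu w) by rewrite lt_def P0 cmod_ge0.
set p := cmod (Cintegral mu w) => p0.
have [|delta delta0 near0] :=
  fourier_near0 (e := p / 2) mdot menorm cauchy_schwarz w1.
  by rewrite divr_gt0.
pose B := [set xi | enorm dot xi <= delta].
have mB : measurable B.
  exact: measurable_enorm_ball.
have W1ge xi : B xi -> p ^+ 2 / 4 <= cmod (fourier mu dot w xi) ^+ 2.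
  move=> /near0; set F := fourier _ _ _ _ => Fp.
  have : p <= cmod F + p / 2.
    rewrite (le_trans _ (lerD (lexx _) Fp))//.
    rewrite /p -[X in cmod X <= _](subKr F).
    rewrite (le_trans (le_normcD _ _))// normcN lerD2l//.
  move=> pF; have ? : p / 2 <= cmod F by lra.
  rewrite (_ : p ^+ 2 / 4 = (p / 2) ^+ 2); last by field.
  by rewrite ler_sqr// nnegrE ?cmod_ge0// divr_ge0// ltW.
have mW0 : measurable_fun setT (fun x => cmod (W0 x)) by exact: measurable_cmod.
have mW0sq : measurable_fun setT (fun x => (cmod (W0 x) ^+ 2)%:E).
  by apply/measurable_EFinP; exact: measurable_funX.
pose K := (\int[mu]_x (cmod (W0 x) ^+ 2)%:E)%E.
have K0 : (0 <= K)%E by apply: integral_ge0 => x _; rewrite lee_fin sqr_ge0.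
have Kfin : K \is a fin_num.
  rewrite ge0_fin_numE//; move: W0oo; rewrite CLnorm2E.
  by apply: lty_poweRy; rewrite invr_eq0.
near=> t.
have ballt : ((c * h t)%:E <= \int[mu]_(xi in B)
    ((sin (enorm dot xi * t) / enorm dot xi) ^+ 2)%:E)%E.
  by near: t; exact: ball_ge.
(* The main term will be at least [p ^+ 2 / 8 * (c * h t)]; from this threshold on, [K] is at most
   half of it, which leaves the factor [c / 16]. *)
have hK : 16 * fine K / (p ^+ 2 * c) <= h t by near: t; exact: cvgry_ge.
pose s xi := sin (enorm dot xi * t) / enorm dot xi.
pose v xi : R := s xi ^+ 2 * \1_B xi * (p ^+ 2 / 8).
have v0 xi : 0 <= v xi.
  by rewrite mulr_ge0 ?divr_ge0 ?sqr_ge0// mulr_ge0 ?sqr_ge0// indicE.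
have ms : measurable_fun setT s by exact: measurable_sinc.
have mv : measurable_fun setT v.
  apply: measurable_funM => //; apply: measurable_funM => //.
  exact: measurable_funX.
set W := wave_fourier dot W0 _ t.
have vW xi : v xi - cmod (W0 xi) ^+ 2 <= cmod (W xi) ^+ 2.
  apply: le_trans (cmod_sqr_comb_ge _ _ _ (cos_max _)).
  rewrite lerD2r /v indicE.
  have [/set_mem Bxi|_] := boolP (xi \in B); last first.
    by rewrite mulr0 mul0r divr_ge0// mulr_ge0// sqr_ge0.
  rewrite mulr1 -/(s xi) -[leRHS]mulrA ler_wpM2l ?sqr_ge0//.
  by have := W1ge _ Bxi; lra.
(* The positive part is measurable and lies below [cmod (W xi) ^+ 2], so additivity is applied to
   [u] and only monotonicity to [W]. Writing [v <= u + cmod W0 ^+ 2] avoids subtracting integrals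
   that may be infinite. *)
pose u xi : R := Num.max 0 (v xi - cmod (W0 xi) ^+ 2).
have mu_u : measurable_fun setT u.
  by apply: measurable_maxr => //; apply: measurable_funB => //;
    exact: measurable_funX.
have uW : (\int[mu]_x (u x)%:E <= \int[mu]_x (cmod (W x) ^+ 2)%:E)%E.
  apply: le_integral_ge0 => x; rewrite lee_fin /u ?le_max ?lexx//.
  by rewrite ge_max vW sqr_ge0.
have vuK : (\int[mu]_x (v x)%:E <= \int[mu]_x (u x)%:E + K)%E.
  rewrite -ge0_integralD//.
  - apply: le_integral_ge0 => x; rewrite lee_fin// -lerBlDr.
    by rewrite /u le_max lexx orbT.
  - by move=> x _; rewrite lee_fin /u le_max lexx.
  - exact/measurable_EFinP.
  - by move=> x _; rewrite lee_fin sqr_ge0.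
have vE : (\int[mu]_x (v x)%:E = (p ^+ 2 / 8)%:E * \int[mu]_(x in B) (s x ^+ 2)%:E)%E.
  rewrite [in RHS]integral_mkcond epatch_indic -ge0_integralZl//.
  - by apply: eq_integral => x _; rewrite /v /= muleC.
  - apply: emeasurable_funM; apply/measurable_EFinP => //.
    exact: measurable_funX.
  - by move=> x _; rewrite mule_ge0// lee_fin ?sqr_ge0.
  - by rewrite lee_fin divr_ge0// sqr_ge0.
have ch : ((p ^+ 2 / 8 * (c * h t))%:E <= \int[mu]_x (v x)%:E)%E.
  by rewrite vE EFinM lee_pmul2l// ?lte_fin ?divr_gt0// ?exprn_gt0.
have pc0 : 0 < p ^+ 2 * c by rewrite mulr_gt0// exprn_gt0.
have ht0 : 0 <= h t.
  by apply: le_trans hK; rewrite divr_ge0 ?(ltW pc0)// mulr_ge0// fine_ge0.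
have key : ((c / 16 * (h t * p ^+ 2))%:E <= \int[mu]_x (cmod (W x) ^+ 2)%:E)%E.
  apply: (le_trans _ uW).
  rewrite -(leeD2rE _ _ Kfin); apply: (le_trans _ vuK); apply: (le_trans _ ch).
  rewrite -(fineK Kfin) -EFinD lee_fin.
  by move: hK; rewrite ler_pdivrMr//; lra.
rewrite CLnorm2E.
have -> : (Num.sqrt (c / 16) * (Num.sqrt (h t) * p))%:E =
    ((c / 16 * (h t * p ^+ 2))%:E `^ 2^-1)%E.
  rewrite poweR_EFin powR12_sqrt; last by rewrite !mulr_ge0// ?sqr_ge0// ltW.
  rewrite (@sqrtrM _ (c / 16)); last by rewrite divr_ge0// ltW.
  by rewrite (@sqrtrM _ (h t))// sqrtr_sqr gtr0_norm.
apply: gt0_ler_poweR => //.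
- by rewrite in_itv/= leey andbT lee_fin !mulr_ge0// ?sqr_ge0// ltW.
- by rewrite in_itv/= leey andbT integral_ge0// => x _; rewrite lee_fin sqr_ge0.
Unshelve. all: by end_near. Qed.

(** A lower sum: the integral is restricted to the disjoint union of the pieces, and on each piece
    the integrand is compared with a constant. *)
Lemma sum_le_integral mu (I : choiceType) (s : seq I) (A : I -> set T) (B : set T)
    (f : T -> R) (a : I -> R) :
  measurable B -> (forall i, measurable (A i)) -> uniq s -> trivIset setT A ->
  measurable_fun setT f -> (forall x, 0 <= f x) ->
  (forall i, i \in s -> 0 <= a i) ->
  (forall i x, i \in s -> A i x -> B x /\ a i <= f x) ->
  (\sum_(i <- s) (a i)%:E * mu (A i) <= \int[mu]_(x in B) (f x)%:E)%E.
Proof.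
move=> mB mA us tA mf f0 a0 af.
have mfE D : measurable_fun D (EFin \o f).
  by apply/measurable_EFinP; exact: measurable_funTS.
apply: (@le_trans _ _ (\int[mu]_(x in \big[setU/set0]_(i <- s) A i) (f x)%:E)%E).
  rewrite ge0_integral_bigsetU//.
  - rewrite big_seq [leRHS]big_seq; apply: lee_sum => i si.
    rewrite -integral_cst//; apply: ge0_le_integral => //.
    + by move=> x _; rewrite lee_fin a0.
    + by move=> x Ax; rewrite lee_fin (af i x si Ax).2.
  - exact: sub_trivIset tA.
  - by move=> x _; rewrite lee_fin.
apply: ge0_subset_integral => //.
- by apply: bigsetU_measurable.
- by move=> x _; rewrite lee_fin.
- by rewrite -bigcup_seq => x [i /= si Ax]; exact: (af i x si Ax).1.
Qed.

End lower_bound.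

(** * Dimension one: linear growth *)

Section dimension_one.
Context {R : realType}.

Lemma enorm_dot1 (x : R) : enorm (@dot1 R) x = `|x|.
Proof. by rewrite /enorm /dot1 -expr2 sqrtr_sqr. Qed.

Lemma measurable_enorm1 : measurable_fun setT (enorm (@dot1 R)).
Proof. by rewrite (funext enorm_dot1); exact: normr_measurable. Qed.

Lemma ball1_ge (delta : R) : 0 < delta -> \forall t \near +oo,
  ((4^-1 * t)%:E <= \int[leb1 R]_(xi in [set xi | (enorm (@dot1 R) xi <= delta)%R])
    ((sin (enorm (@dot1 R) xi * t) / enorm (@dot1 R) xi) ^+ 2)%:E)%E.
Proof.
move=> delta0; near=> t.
have t0 : 0 < t by near: t; exact: nbhs_pinfty_gt.
have td : delta^-1 <= t by near: t; apply: nbhs_pinfty_ge; rewrite num_real.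
have tV : t^-1 <= delta by rewrite -[delta]invrK lef_pV2// posrE invr_gt0.
(* A lower sum with a single piece of length [1 / t], on which the integrand is at least
   [(t / 2) ^+ 2]. The interval is open at 0, where the quotient takes the default value 0. *)
have -> : (4^-1 * t)%:E =
    (\sum_(i <- [:: tt]) (t ^+ 2 / 4)%:E * leb1 R `]0%R, t^-1%R]%classic)%E.
  have -> : leb1 R `]0%R, t^-1%R]%classic = t^-1%:E.
    have := @lebesgue_measure_itv R `]0, t^-1].
    by rewrite /= lte_fin invr_gt0 t0 sube0.
  rewrite big_seq1 -EFinM; congr EFin; field.
  by rewrite gt_eqF.
apply: (@sum_le_integral _ _ _ (leb1 R) _ [:: tt] (fun=> `]0, t^-1]%classic)
  _ _ (fun=> t ^+ 2 / 4)) => //.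
- by apply: measurable_enorm_ball; exact: measurable_enorm1.
- by move=> [] [].
- by apply: measurable_funX; apply: measurable_sinc; exact: measurable_enorm1.
- by move=> x; rewrite sqr_ge0.
- by move=> _ _; rewrite divr_ge0// sqr_ge0.
move=> _ x _; rewrite /= in_itv/= !enorm_dot1 => /andP[x0 xt].
rewrite gtr0_norm//; split; first exact: le_trans tV.
rewrite (_ : t ^+ 2 / 4 = (t / 2) ^+ 2); last by field.
have xt1 : x * t <= 1 by rewrite -ler_pdivlMr// div1r.
have : t / 2 <= sin (x * t) / x.
  rewrite ler_pdivlMr// mulrAC [t * x]mulrC sin_ge_half// xt1 andbT.
  by rewrite mulr_ge0// ltW.
have t20 : 0 <= t / 2 by rewrite divr_ge0// ltW.
by move=> tsin; rewrite ler_sqr// nnegrE//; exact: le_trans tsin.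
Unshelve. all: by end_near. Qed.

End dimension_one.

(** * Dimension two: logarithmic growth from boxes around lattice points *)

Section dimension_two.
Context {R : realType}.
Implicit Types (x y a b t : R) (xi : R * R).

(** Identifying the plane with the complex numbers makes the triangle inequality for [cmod]
    available. *)
Lemma enorm_dot2 xi : enorm (@dot2 R) xi = cmod (xi.1 +i* xi.2).
Proof. by rewrite /enorm /dot2 /cmod/= !expr2. Qed.

Lemma measurable_enorm2 : measurable_fun setT (enorm (@dot2 R)).
Proof.
rewrite (funext enorm_dot2); apply: measurable_cmod => /=.
  exact: measurable_fst.
exact: measurable_snd.
Qed.

Lemma cauchy_schwarz_dot2 (u v : R * R) :
  `|dot2 u v| <= enorm (@dot2 R) u * enorm (@dot2 R) v.
Proof.
rewrite -ler_sqr ?nnegrE ?mulr_ge0 ?sqrtr_ge0// exprMn !enorm_dot2 !cmod_sqr/=.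
rewrite real_normK ?num_real// -subr_ge0 /dot2.
(* Lagrange's identity. *)
rewrite (_ : _ - _ = (u.1 * v.2 - u.2 * v.1) ^+ 2) ?sqr_ge0//.
by ring.
Qed.

Lemma cmod_lipschitz x y a b :
  `|cmod (x +i* y) - cmod (a +i* b)| <= `|x - a| + `|y - b|.
Proof.
have H x' y' a' b' :
    cmod (x' +i* y') - cmod (a' +i* b') <= `|x' - a'| + `|y' - b'| :> R.
  rewrite lerBlDr.
  have -> : x' +i* y' = ((x' - a') +i* (y' - b')) + (a' +i* b').
    by rewrite /GRing.add/= !subrK.
  apply: le_trans (le_normcD _ _) _.
  by rewrite lerD2r; exact: (cmod_le_ReIm ((x' - a') +i* (y' - b'))).
rewrite ler_norml H andbT lerNl opprB.
by rewrite (distrC x) (distrC y).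
Qed.

(** Two moduli with small sines must differ by an amount whose sine is small too. *)
Lemma normr_sinB_le x y : `|sin (x - y)| <= `|sin x| + `|sin y|.
Proof.
rewrite sinB (le_trans (ler_normB _ _))// !normrM.
by rewrite lerD// ?ler_piMr ?ler_piMl// cos_max.
Qed.

(* Moving the corner (j, k) to (j + 1/2, k) changes the modulus by an amount
   between 1/4 and 1/2, so the sine of the modulus cannot be small at both
   points. *)
Lemma sin_cmod_shift (j k : nat) : (k < j)%N ->
  16^-1 <= `|sin (cmod (j%:R +i* k%:R : R[i]))| \/
  16^-1 <= `|sin (cmod ((j%:R + 2^-1) +i* k%:R : R[i]))|.
Proof.
move=> kj.
set r := cmod (j%:R +i* k%:R : R[i]).
set r' := cmod ((j%:R + 2^-1) +i* k%:R : R[i]).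
have k0 : 0 <= k%:R :> R by [].
have kjR : k%:R + 1 <= j%:R :> R by rewrite natr1 ler_nat.
have r0 : 0 <= r by exact: cmod_ge0.
have r'0 : 0 <= r' by exact: cmod_ge0.
have rE : r ^+ 2 = j%:R ^+ 2 + k%:R ^+ 2 by rewrite cmod_sqr.
have r'E : r' ^+ 2 = (j%:R + 2^-1) ^+ 2 + k%:R ^+ 2 by rewrite cmod_sqr.
have r'r : r' - r <= 2^-1.
  rewrite (le_trans (ler_norm _))// (le_trans (cmod_lipschitz _ _ _ _))//.
  by rewrite subrr normr0 addr0 addrAC subrr add0r ger0_norm.
have rj : r <= 3 / 2 * j%:R.
  rewrite -ler_sqr ?nnegrE ?mulr_ge0// rE; nra.
(* Difference of squares: [r' + r <= 3 * j + 1 / 2], while the product with [r' - r] is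
   [j + 1 / 4]. *)
have rr' : 4^-1 <= r' - r.
  have : (r' - r) * (r' + r) = j%:R + 4^-1.
    by rewrite -subr_sqr rE r'E; field.
  nra.
(* Hence the two sines cannot both be below [1 / 16] in absolute value. *)
have : 8^-1 <= sin (r' - r).
  have /sin_ge_half : 0 <= r' - r <= 1 by apply/andP; split; lra.
  by lra.
have := normr_sinB_le r' r; have := ler_norm (sin (r' - r)).
have [|?] := leP 16^-1 `|sin r|; first by left.
by right; lra.
Qed.

(** The abscissa of whichever of the two points of [sin_cmod_shift] has a large sine. *)
Definition corner (p : nat * nat) : R :=
  if 16^-1 <= `|sin (cmod (p.1%:R +i* p.2%:R : R[i]))| then p.1%:R
  else p.1%:R + 2^-1.

Lemma corner_itv p : p.1%:R <= corner p <= p.1%:R + 2^-1.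
Proof. by rewrite /corner; case: ifP => _; apply/andP; split; lra. Qed.

Lemma sin_corner p : (p.2 < p.1)%N ->
  16^-1 <= `|sin (cmod (corner p +i* p.2%:R))|.
Proof.
by move=> /sin_cmod_shift; rewrite /corner; case: ifPn => // _ [].
Qed.

(** After scaling by [t] the side is [1 / 64], short enough for the sine of the modulus to vary by
    at most [1 / 32] from its value at the corner. *)
Definition box t (p : nat * nat) : set (R * R) :=
  `[corner p / t, (corner p + 64^-1) / t] `*`
  `[p.2%:R / t, (p.2%:R + 64^-1) / t].

Lemma boxE t p xi : 0 < t -> box t p xi ->
  (corner p <= xi.1 * t <= corner p + 64^-1) /\
  (p.2%:R <= xi.2 * t <= p.2%:R + 64^-1).
Proof.
move=> t0 [/=]; rewrite !in_itv/=.
by rewrite !ler_pdivrMr// !ler_pdivlMr.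
Qed.

(** Since [1 / 2 + 1 / 64 < 1], the scaled box stays in the unit cell with lower left corner [p], so
    integer parts recover [p]. *)
Lemma trivIset_box t : 0 < t -> trivIset setT (box t).
Proof.
move=> t0 p q _ _ [xi [/(boxE t0)[/andP[p1 p1'] /andP[p2 p2']]
  /(boxE t0)[/andP[q1 q1'] /andP[q2 q2']]]].
have /andP[pc pc'] := corner_itv p; have /andP[qc qc'] := corner_itv q.
have lt_nat (m n : nat) : m%:R < n%:R + 1 :> R -> (m <= n)%N.
  by rewrite natr1 ltr_nat ltnS.
have E1 : p.1 = q.1 by apply/eqP; rewrite eqn_leq !lt_nat//; lra.
have E2 : p.2 = q.2 by apply/eqP; rewrite eqn_leq !lt_nat//; lra.
by case: p q E1 E2 {p1 p1' p2 p2' q1 q1' q2 q2' pc pc' qc qc'} =>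
  p1 p2 [q1 q2] /= -> ->.
Qed.

Lemma measurable_box t p : measurable (box t p).
Proof. by apply: measurableX; exact: measurable_itv. Qed.

Lemma leb2_box t p : 0 < t -> leb2 R (box t p) = ((64 * t) ^- 2)%:E.
Proof.
move=> t0.
have itvE x : leb1 R `[(x / t)%R, ((x + 64^-1) / t)%R]%classic = ((64 * t)^-1)%:E.
  have := @lebesgue_measure_itv R `[x / t, (x + 64^-1) / t].
  rewrite /= lte_fin ltr_pM2r ?invr_gt0// ltrDl invr_gt0 ltr0n/= => ->.
  by rewrite -EFinD; congr EFin; field; rewrite gt_eqF.
transitivity (leb1 R `[(corner p / t)%R, ((corner p + 64^-1) / t)%R]%classic *
    leb1 R `[(p.2%:R / t)%R, ((p.2%:R + 64^-1) / t)%R]%classic)%E.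
  by apply: product_measure1E; exact: measurable_itv.
by rewrite !itvE -EFinM -exprVn expr2.
Qed.

Lemma cmodZ t x y : 0 <= t -> cmod (x +i* y) * t = cmod (x * t +i* (y * t)).
Proof.
move=> t0; rewrite /cmod/= !exprMn -mulrDl sqrtrM ?addr_ge0 ?sqr_ge0//.
by rewrite sqrtr_sqr ger0_norm.
Qed.

(** On the box the sine is at least [1 / 16 - 1 / 32 = 1 / 32] in absolute value and the modulus is
    at most [3 * p.1 / t], whence the 96. *)
Lemma box_sinc_ge t p xi : 0 < t -> (p.2 < p.1)%N -> box t p xi ->
  enorm (@dot2 R) xi <= 3 * p.1%:R / t /\
  (t / (96 * p.1%:R)) ^+ 2 <=
    (sin (enorm (@dot2 R) xi * t) / enorm (@dot2 R) xi) ^+ 2.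
Proof.
move=> t0 p21 pxi; have [/andP[c1 c1'] /andP[c2 c2']] := boxE t0 pxi.
have /andP[pc pc'] := corner_itv p.
have k0 : 0 <= p.2%:R :> R by [].
have kj : p.2%:R + 1 <= p.1%:R :> R by rewrite natr1 ler_nat.
rewrite enorm_dot2; set r := cmod _.
have rt : r * t = cmod (xi.1 * t +i* (xi.2 * t)) by rewrite cmodZ// ltW.
have rt3 : r * t <= 3 * p.1%:R.
  rewrite rt (le_trans (cmod_le_ReIm _))//= !ger0_norm; lra.
(* Positivity of [r], required for dividing by it, comes from [p.1 >= 1]. *)
have rt1 : 1 <= r * t.
  rewrite rt (le_trans _ (normr_Re_le_cmod _))//= ger0_norm; lra.
have r0 : 0 < r by rewrite -(pmulr_lgt0 _ t0); lra.
split; first by rewrite ler_pdivlMr.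
have sin_ge : 32^-1 <= `|sin (r * t)|.
  have := sin_corner p21; set s := cmod _ => sins.
  have : `|sin s - sin (r * t)| <= 32^-1.
    rewrite (le_trans (sin_lipschitz _ _))// rt.
    rewrite (le_trans (cmod_lipschitz _ _ _ _))// distrC ger0_norm ?subr_ge0//.
    by rewrite distrC ger0_norm ?subr_ge0//; lra.
  have := ler_normD (sin s - sin (r * t)) (sin (r * t)); rewrite subrK; lra.
have le : t / (96 * p.1%:R) <= `|sin (r * t)| / r.
  rewrite ler_pdivlMr// mulrAC ler_pdivrMr; last by lra.
  nra.
rewrite -[leRHS]real_normK ?num_real// normrM normfV (gtr0_norm r0).
rewrite ler_sqr// nnegrE divr_ge0 ?normr_ge0 ?ltW//; lra.
Qed.

(** Induction: passing from [N + 1] to [N + 2] adds [ln (1 + 1 / (N + 1)) <= 1 / (N + 1)]. *)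
Lemma ln_le_sum_inv (N : nat) :
  ln N.+1%:R <= \sum_(j <- iota 1 N) j%:R^-1 :> R.
Proof.
elim: N => [|N IH]; first by rewrite ln1 big_nil.
rewrite -[X in iota 1 X]addn1 iotaD big_cat big_seq1 add1n.
rewrite (_ : N.+2%:R = N.+1%:R * (1 + N.+1%:R^-1)); last first.
  by rewrite mulrDr mulr1 divff// natr1.
rewrite lnM ?posrE ?addr_gt0 ?invr_gt0//; apply: lerD => //.
by rewrite le_ln1Dx// (lt_trans (ltrN10 _))// invr_gt0.
Qed.

Lemma ln_cvg_pinfty : ln t @[t --> +oo] --> (+oo : set_system R).
Proof.
apply/cvgryPge => A; near=> t.
have At : expR A <= t by near: t; apply: nbhs_pinfty_ge; rewrite num_real.
by rewrite -(expRK A) ler_ln ?posrE ?expR_gt0// (lt_le_trans _ At) ?expR_gt0.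
Unshelve. all: by end_near. Qed.

Lemma ball2_ge : exists2 c : R, 0 < c &
  forall delta, 0 < delta -> \forall t \near +oo,
  ((c * ln t)%:E <=
    \int[leb2 R]_(xi in [set xi | (enorm (@dot2 R) xi <= delta)%R])
    ((sin (enorm (@dot2 R) xi * t) / enorm (@dot2 R) xi) ^+ 2)%:E)%E.
Proof.
(* A box contributes [(t / (96 j))^2] times its area [(64 t)^-2], that is [c / j^2]. The further
   factor [1 / 2] comes from [ln (Num.sqrt t) = ln t / 2]. *)
pose c : R := (96 * 64) ^- 2.
have c0 : 0 < c by rewrite invr_gt0 exprn_gt0.
exists (c / 2); first by rewrite divr_gt0.
move=> delta delta0; near=> t.
have t0 : 0 < t by near: t; exact: nbhs_pinfty_gt.
(* Boxes with [j <= Num.sqrt t] lie within radius [3 * j / t <= 3 / Num.sqrt t], hence in the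
   ball. *)
have td : (3 / delta) ^+ 2 <= t.
  by near: t; apply: nbhs_pinfty_ge; rewrite num_real.
have q0 : 0 < Num.sqrt t by rewrite sqrtr_gt0.
have qt : Num.sqrt t ^+ 2 = t by rewrite sqr_sqrtr// ltW.
have {td} qd : 3 <= delta * Num.sqrt t.
  rewrite mulrC -ler_pdivrMr// -ler_sqr ?qt// nnegrE ?divr_ge0 ?ltW//.
pose N := Num.truncn (Num.sqrt t).
have /andP[Nq qN] : N%:R <= Num.sqrt t < N.+1%:R.
  by apply: truncn_itv; rewrite ltW.
pose s := [seq (j, k) | j <- iota 1 N, k <- iota 0 j].
have sP p : p \in s -> (p.2 < p.1 <= N)%N.
  move=> /allpairsPdep[j [k [+ + ->]]] /=.
  by rewrite !mem_iota add0n add1n ltnS => /andP[_ ->] /andP[_ ->].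
pose a (p : nat * nat) : R := (t / (96 * p.1%:R)) ^+ 2.
apply: (@le_trans _ _ (\sum_(p <- s) (a p)%:E * leb2 R (box t p))%E); last first.
  apply: sum_le_integral.
  - by apply: measurable_enorm_ball; exact: measurable_enorm2.
  - exact: measurable_box.
  - apply: allpairs_uniq_dep => [|j _|]; [exact: iota_uniq..|].
    by move=> [j k] [j' k'] /= _ _ [-> ->].
  - exact: trivIset_box.
  - by apply: measurable_funX; apply: measurable_sinc; exact: measurable_enorm2.
  - by move=> xi; rewrite sqr_ge0.
  - by move=> p _; rewrite sqr_ge0.
  - move=> p xi /sP /andP[p21 p1N] /(box_sinc_ge t0 p21)[xip ?]; split => //=.
    rewrite (le_trans xip)// ler_pdivrMr//.
    have : p.1%:R <= Num.sqrt t by rewrite (le_trans _ Nq)// ler_nat.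
    by move=> pq; rewrite -qt; nra.
rewrite (_ : (\sum_(p <- s) _)%E = (\sum_(p <- s) c * p.1%:R ^- 2)%:E).
  rewrite lee_fin big_allpairs_dep/=.
  (* The [j] values of [k] cancel one factor of [j^-2], which leaves the harmonic sum. *)
  apply: (@le_trans _ _ (\sum_(j <- iota 1 N) c * j%:R^-1)); last first.
    rewrite big_seq [leRHS]big_seq; apply: ler_sum => j.
    rewrite mem_iota => /andP[j1 _].
    rewrite big_const_seq count_predT size_iota iter_addr_0.
    rewrite -[leRHS]mulr_natr -[leRHS]mulrA ler_wpM2l ?(ltW c0)//.
    by rewrite expr2 invfM -mulrA mulVf ?mulr1// pnatr_eq0 -lt0n.
  rewrite -mulr_sumr -mulrA ler_wpM2l ?(ltW c0)//.
  apply: le_trans (ln_le_sum_inv N).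
  (* The harmonic sum up to [N] dominates [ln (N + 1)], and [N + 1] exceeds [Num.sqrt t] because [N]
     is its integer part. *)
  apply: (@le_trans _ _ (ln (Num.sqrt t))); last first.
    by rewrite ler_ln ?posrE// ltW.
  by have -> : ln t = ln (Num.sqrt t) *+ 2; [rewrite -lnXn// qt|lra].
rewrite -sumEFin big_seq [RHS]big_seq; apply: eq_bigr => p /sP /andP[p21 _].
have p0 : p.1%:R != 0 :> R by rewrite pnatr_eq0 -lt0n (leq_ltn_trans _ p21).
have tn0 : t != 0 by rewrite gt_eqF.
by rewrite leb2_box// -EFinM; congr EFin; rewrite /a /c; field; rewrite ?p0 ?tn0.
Unshelve. all: by end_near. Qed.

End dimension_two.

(** In both dimensions the constant is the Plancherel weight times [Num.sqrt (c / 16)], with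
    [c = 1 / 4] in dimension one and [c] from [ball2_ge] in dimension two. *)
Theorem corollaryA1 (R : realType) :
  (exists2 C : R, 0 < C &
    forall w0 w1 W0 : measurableTypeR R -> R[i],
      inLp (leb1 R) 2 w0 -> inLp (leb1 R) 1 w1 ->
      is_fourier_L2 (leb1 R) (@dot1 R) w0 W0 ->
      \forall t \near +oo,
        ((C * (Num.sqrt t * cmod (Cintegral (leb1 R) w1)))%:E
         <= plancherel_norm (leb1 R) 1
              (wave_fourier (@dot1 R) W0 (fourier (leb1 R) (@dot1 R) w1) t))%E)
  /\
  (exists2 C : R, 0 < C &
    forall w0 w1 W0 : measurableTypeR R * measurableTypeR R -> R[i],
      inLp (leb2 R) 2 w0 -> inLp (leb2 R) 1 w1 ->
      is_fourier_L2 (leb2 R) (@dot2 R) w0 W0 ->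
      \forall t \near +oo,
        ((C * (Num.sqrt (ln t) * cmod (Cintegral (leb2 R) w1)))%:E
         <= plancherel_norm (leb2 R) 2
              (wave_fourier (@dot2 R) W0 (fourier (leb2 R) (@dot2 R) w1) t))%E).
Proof.
have weight_gt0 (n : nat) : 0 < (2 * pi) `^ (- (n%:R / 2)) :> R.
  by rewrite powR_gt0// mulr_gt0// pi_gt0.
have plancherel_ge d (T : measurableType d) (mu : {measure set T -> \bar R})
    (n : nat) (a b : R) (F : T -> R[i]) : ((a * b)%:E <= CLnorm mu 2 F)%E ->
    (((2 * pi) `^ (- (n%:R / 2)) * a * b)%:E <= plancherel_norm mu n F)%E.
  by move=> abF; rewrite /plancherel_norm -mulrA EFinM lee_pmul2l// lte_fin.
split.
- exists ((2 * pi) `^ (- (1%:R / 2)) * Num.sqrt (4^-1 / 16)).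
    by rewrite mulr_gt0// sqrtr_gt0 divr_gt0// invr_gt0.
  move=> w0 w1 W0 _ w1L1 [W0L2 _].
  have : \forall t \near +oo, ((Num.sqrt (4^-1 / 16) *
      (Num.sqrt t * cmod (Cintegral (leb1 R) w1)))%:E <= CLnorm (leb1 R) 2
      (wave_fourier (@dot1 R) W0 (fourier (leb1 R) (@dot1 R) w1) t))%E.
    apply: (@wave_fourier_ge _ _ _ (leb1 R) (@dot1 R) 4^-1 id) => //.
    + by move=> xi; apply: measurable_funM.
    + exact: measurable_enorm1.
    + by move=> x xi; rewrite !enorm_dot1 normrM.
    + exact: ball1_ge.
  by apply: filterS => t; exact: plancherel_ge.
- have [c c0 ball2] := @ball2_ge R.
  exists ((2 * pi) `^ (- (2%:R / 2)) * Num.sqrt (c / 16)).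
    by rewrite mulr_gt0// sqrtr_gt0 divr_gt0.
  move=> w0 w1 W0 _ w1L1 [W0L2 _].
  have : \forall t \near +oo, ((Num.sqrt (c / 16) *
      (Num.sqrt (ln t) * cmod (Cintegral (leb2 R) w1)))%:E <= CLnorm (leb2 R) 2
      (wave_fourier (@dot2 R) W0 (fourier (leb2 R) (@dot2 R) w1) t))%E.
    apply: (@wave_fourier_ge _ _ _ (leb2 R) (@dot2 R) c (@ln R)) => //.
    + by move=> xi; apply: measurable_funD; apply: measurable_funM.
    + exact: measurable_enorm2.
    + exact: cauchy_schwarz_dot2.
    + exact: ln_cvg_pinfty.
  by apply: filterS => t; exact: plancherel_ge.
Qed.
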